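(* For all linear $\lambda$-terms $M$ and $N$ and every name $o$: if $M \Rightarrow N$, then there is a derivation in $\mathsf{BVQ}$ with premise $[\![N]\!]_o$ and conclusion $[\![M]\!]_o$.
   Context: The system $\mathsf{BVQ}$. Fix a countably infinite set of names $a,b,c,\dots$. Structures are generated by $R ::= \circ \mid a \mid \bar a \mid [R;R] \mid (R;R) \mid \langle R;R\rangle \mid \mathsf{Sdq}\,a.R$ (unit, atom, negated atom, Par, Copar, Seq, and the self-dual quantifier $\mathsf{Sdq}$, which binds the name $a$ in $R$). $\mathrm{fn}(R)$ is the set of names with a free occurrence (as $a$ or $\bar a$) in $R$; $\mathrm{bn}(R)$ is the set of names bound by some occurrence of $\mathsf{Sdq}$ in $R$. $R\{b/a\}$ is the capture-avoiding replacement of the free occurrences of $a$ (in both $a$ and $\bar a$) by $b$. Structures are considered modulo $\approx$, the least congruence such that Par, Copar and Seq are associative, Par and Copar are commutative, $\circ$ is a unit for Par, Copar and Seq, $\mathsf{Sdq}\,a.R \approx R$ if $a\notin\mathrm{fn}(R)$, $\mathsf{Sdq}\,a.R \approx \mathsf{Sdq}\,b.R\{b/a\}$ if $b\notin\mathrm{fn}(R)$, and $\mathsf{Sdq}\,a.\mathsf{Sdq}\,b.R\approx\mathsf{Sdq}\,b.\mathsf{Sdq}\,a.R$. A context $S\{\ \}$ is a structure with one hole; $S\{R\}$ is the result of filling it with $R$. The rules of $\mathsf{BVQ}$, each written premise $\Longrightarrow$ conclusion and applicable in any context $S\{\ \}$, are: $\mathsf{ai}{\downarrow}$: $S\{\circ\}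 \Longrightarrow S[a;\bar a]$; $\mathsf{s}$: $S([R;U];T) \Longrightarrow S[(R;T);U]$; $\mathsf{q}{\downarrow}$: $S\langle [R;U];[T;V]\rangle \Longrightarrow S[\langle R;T\rangle;\langle U;V\rangle]$; $\mathsf{u}{\downarrow}$: $S\{\mathsf{Sdq}\,a.[R;U]\} \Longrightarrow S[\mathsf{Sdq}\,a.R;\mathsf{Sdq}\,a.U]$. A derivation with premise $T$ and conclusion $R$ is a finite sequence of structures from $T$ to $R$ (possibly of length zero, modulo $\approx$) in which each structure is obtained from the previous one by one rule instance. Linear $\lambda$-calculus. Variables are names. For finite sets $X$ of names define $\Lambda_X$: $x\in\Lambda_{\{x\}}$; $\lambda x.M\in\Lambda_X$ if $M\in\Lambda_{X\cup\{x\}}$; $MN\in\Lambda_{X\cup Y}$ if $M\in\Lambda_X$, $N\in\Lambda_Y$ and $X\cap Y=\emptyset$. Linear $\lambda$-terms are the elements of $\bigcup_X \Lambda_X$. $M\{N/x\}$ is the usual clash-free substitution of $N$ for the single occurrence of $x$ in $M$. The relation $\Rightarrow$ is the least relation on linear $\lambda$-terms such that $M\Rightarrow M$; $(\lambda x.M)N\Rightarrow M\{N/x\}$; $M\Rightarrow P$ and $P\Rightarrow N$ imply $M\Rightarrow N$; and $M\Rightarrow N$ implies $\lambda x.M\Rightarrow\lambda x.N$, $MP\Rightarrow NP$ and $PM\Rightarrow PN$. The map to structures: $[\![x]\!]_o=\langle x;\bar o\rangle$ with $o$ a fresh name; $[\![\lambda x.M]\!]_o=\mathsf{Sdq}\,x.[\![M]\!]_o$;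 $[\![MN]\!]_o=\mathsf{Sdq}\,p.[\,[\![M]\!]_p;\ \mathsf{Sdq}\,q.[\![N]\!]_q;\ \langle p;\bar o\rangle\,]$ with $p,q$ fresh names.
   Formalization: In the clause for λx.M ∈ Λ_X the union X ∪ {x} is taken to be disjoint (x ∉ X); read literally, λx.λx.x would be linear and (λx.λx.x)y ⇒ λx.x would erase y, which makes the claim false. *)

(* Defs.v *)
From mathcomp Require Import all_boot finmap.

Set Implicit Arguments.
Unset Strict Implicit.
Unset Printing Implicit Defensive.

Local Open Scope fset_scope.

Definition name := nat.

Definition fresh (X : {fset name}) : name := (\max_(x <- X) x).+1.

Lemma freshP (X : {fset name}) : fresh X \notin X.
Proof.
apply/negP => h; have := leq_bigmax_seq (P := xpredT) (F := id) _ h isT.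
by rewrite ltnn.
Qed.

Definition upd (A : Type) (s : name -> A) (a : name) (v : A) : name -> A :=
  fun x => if x == a then v else s x.

Inductive structure : Type :=
| Unit
| Pos of name
| Neg of name
| Par of structure & structure
| Copar of structure & structure
| Seq of structure & structure
| Sdq of name & structure.

Fixpoint fn (R : structure) : {fset name} :=
  match R with
  | Unit => fset0
  | Pos a | Neg a => [fset a]
  | Par R T | Copar R T | Seq R T => fn R `|` fn T
  | Sdq a R => fn R `\ a
  end.

(* Simultaneous capture-avoiding renaming of the free names of [R] by [s]; a
   bound name is changed only when it would capture an image under [s]. *)
Fixpoint srename (s : name -> name) (R : structure) : structure :=
  match R with
  | Unit => Unit
  | Pos a => Pos (s a)
  | Neg a => Neg (s a)
  | Par R T => Par (srename s R) (srename s T)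
  | Copar R T => Copar (srename s R) (srename s T)
  | Seq R T => Seq (srename s R) (srename s T)
  | Sdq a R =>
      let X := [fset s x | x in fn R `\ a] in
      let c := if a \in X then fresh X else a in
      Sdq c (srename (upd s a c) R)
  end.

(* R{b/a} *)
Definition srepl (R : structure) (b a : name) : structure :=
  srename (upd id a b) R.

Reserved Notation "R ≈ T" (at level 70, no associativity).

Inductive seqv : structure -> structure -> Prop :=
| seqv_refl R : R ≈ R
| seqv_sym R T : R ≈ T -> T ≈ R
| seqv_trans R T U : R ≈ T -> T ≈ U -> R ≈ U
| seqv_par R R' T T' : R ≈ R' -> T ≈ T' -> Par R T ≈ Par R' T'
| seqv_copar R R' T T' : R ≈ R' -> T ≈ T' -> Copar R T ≈ Copar R' T'
| seqv_seq R R' T T' : R ≈ R' -> T ≈ T' -> Seq R T ≈ Seq R' T'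
| seqv_sdq a R R' : R ≈ R' -> Sdq a R ≈ Sdq a R'
| seqv_parA R T U : Par R (Par T U) ≈ Par (Par R T) U
| seqv_coparA R T U : Copar R (Copar T U) ≈ Copar (Copar R T) U
| seqv_seqA R T U : Seq R (Seq T U) ≈ Seq (Seq R T) U
| seqv_parC R T : Par R T ≈ Par T R
| seqv_coparC R T : Copar R T ≈ Copar T R
| seqv_par0 R : Par Unit R ≈ R
| seqv_copar0 R : Copar Unit R ≈ R
| seqv_seq0l R : Seq Unit R ≈ R
| seqv_seq0r R : Seq R Unit ≈ R
| seqv_sdq_vac a R : a \notin fn R -> Sdq a R ≈ R
| seqv_sdq_alpha a b R : b \notin fn R -> Sdq a R ≈ Sdq b (srepl R b a)
| seqv_sdqC a b R : Sdq a (Sdq b R) ≈ Sdq b (Sdq a R)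
where "R ≈ T" := (seqv R T).

Inductive context : Type :=
| Hole
| ParL of context & structure
| ParR of structure & context
| CoparL of context & structure
| CoparR of structure & context
| SeqL of context & structure
| SeqR of structure & context
| SdqC of name & context.

(* Filling a hole may capture free names of [R]. *)
Fixpoint fill (K : context) (R : structure) : structure :=
  match K with
  | Hole => R
  | ParL K T => Par (fill K R) T
  | ParR T K => Par T (fill K R)
  | CoparL K T => Copar (fill K R) T
  | CoparR T K => Copar T (fill K R)
  | SeqL K T => Seq (fill K R) T
  | SeqR T K => Seq T (fill K R)
  | SdqC a K => Sdq a (fill K R)
  end.

(* [bvq_rule P C]: one rule instance with premise [P] and conclusion [C]. *)
Inductive bvq_rule : structure -> structure -> Prop :=
| rule_ai K a :
    bvq_rule (fill K Unit) (fill K (Par (Pos a) (Neg a)))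
| rule_s K R T U :
    bvq_rule (fill K (Copar (Par R U) T)) (fill K (Par (Copar R T) U))
| rule_q K R T U V :
    bvq_rule (fill K (Seq (Par R U) (Par T V)))
             (fill K (Par (Seq R T) (Seq U V)))
| rule_u K a R U :
    bvq_rule (fill K (Sdq a (Par R U))) (fill K (Par (Sdq a R) (Sdq a U))).

(* [bvq_derivation T R]: premise [T], conclusion [R]. *)
Inductive bvq_derivation : structure -> structure -> Prop :=
| deriv_nil T R : T ≈ R -> bvq_derivation T R
| deriv_cons T T1 T2 R :
    T ≈ T1 -> bvq_rule T1 T2 -> bvq_derivation T2 R -> bvq_derivation T R.

Inductive term : Type :=
| Var of name
| Lam of name & term
| App of term & term.

Fixpoint fv (M : term) : {fset name} :=
  match M with
  | Var x => [fset x]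
  | Lam x M => fv M `\ x
  | App M N => fv M `|` fv N
  end.

Fixpoint names (M : term) : {fset name} :=
  match M with
  | Var x => [fset x]
  | Lam x M => x |` names M
  | App M N => names M `|` names N
  end.

(* Simultaneous capture-avoiding substitution, with the same treatment of
   binders as [srename]. *)
Fixpoint tsubst (s : name -> term) (M : term) : term :=
  match M with
  | Var x => s x
  | Lam x M =>
      let X := \bigcup_(y <- fv M `\ x) fv (s y) in
      let z := if x \in X then fresh X else x in
      Lam z (tsubst (upd s x (Var z)) M)
  | App M N => App (tsubst s M) (tsubst s N)
  end.

(* M{N/x} *)
Definition subst (M N : term) (x : name) : term := tsubst (upd Var x N) M.

Inductive alpha : term -> term -> Prop :=
| alpha_refl M : alpha M M
| alpha_sym M N : alpha M N -> alpha N M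
| alpha_trans M N P : alpha M N -> alpha N P -> alpha M P
| alpha_lam x M N : alpha M N -> alpha (Lam x M) (Lam x N)
| alpha_app M M' N N' : alpha M M' -> alpha N N' -> alpha (App M N) (App M' N')
| alpha_conv x y M :
    y \notin fv M -> alpha (Lam x M) (Lam y (subst M (Var y) x)).

(* [linear_in X M] is M ∈ Λ_X.  Without [x \notin X] in the abstraction
   clause, λx.λx.x would be in Λ_∅, although its outer binder is vacuous and
   its α-variant λy.λx.x is in no Λ_X. *)
Inductive linear_in : {fset name} -> term -> Prop :=
| linear_var (x : name) : linear_in [fset x] (Var x)
| linear_lam (X : {fset name}) (x : name) M :
    x \notin X -> linear_in (x |` X) M -> linear_in X (Lam x M)
| linear_app (X Y : {fset name}) M N :
    linear_in X M -> linear_in Y N -> [disjoint X & Y] ->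
    linear_in (X `|` Y) (App M N).

Definition linear_term (M : term) : Prop := exists X, linear_in X M.

Reserved Notation "M ⇒ N" (at level 70, no associativity).

(* Terms are taken up to α-equivalence, hence the form of [red_refl].  Each
   clause asks for a linear source; the target is then linear too. *)
Inductive red : term -> term -> Prop :=
| red_refl M N : linear_term M -> alpha M N -> M ⇒ N
| red_beta x M N : linear_term (App (Lam x M) N) ->
    App (Lam x M) N ⇒ subst M N x
| red_trans M P N : M ⇒ P -> P ⇒ N -> M ⇒ N
| red_lam x M N : linear_term (Lam x M) -> M ⇒ N -> Lam x M ⇒ Lam x N
| red_appl M N P : linear_term (App M P) -> M ⇒ N -> App M P ⇒ App N P
| red_appr M N P : linear_term (App P M) -> M ⇒ N -> App P M ⇒ App P N
where "M ⇒ N" := (red M N).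

(* [interp M o] is ⟦M⟧_o.  The bound names introduced for an application avoid
   every name of the term, so [x == o] arises only for an [o] given from
   outside; the abstraction is then interpreted at a fresh name, which
   capture-avoiding renaming turns into [o].  The result is
   Sdq z.⟦M{z/x}⟧_o with z fresh, up to ≈. *)
Fixpoint interp (M : term) (o : name) : structure :=
  match M with
  | Var x => Seq (Pos x) (Neg o)
  | Lam x M =>
      if x == o then
        let o' := fresh (o |` names M) in
        srepl (Sdq x (interp M o')) o o'
      else Sdq x (interp M o)
  | App M N =>
      let p := fresh (o |` (names M `|` names N)) in
      let q := fresh (p |` (o |` (names M `|` names N))) in
      Sdq p (Par (interp M p)
                 (Par (Sdq q (interp N q)) (Seq (Pos p) (Neg o))))
  end.

(* Main.v *)
Require Import Defs.
From mathcomp Require Import all_boot finmap.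

(** Structures are compared through de Bruijn representations: two structures
    with the same representation are [≈]-equal, and the representation of
    ⟦M⟧_o depends only on [M] up to α, so every bound name may be taken fresh.
    Reading derivations upwards, ⟨p;ō⟩ next to ⟦M⟧_p is absorbed by the output
    of [M], giving ⟦M⟧_o.  By linearity [x] occurs once in [M], so ⟦N⟧_x next
    to ⟦M⟧_o is pushed through the quantifiers of ⟦M⟧_o down to the atom ⟨x;ō'⟩,
    where the same absorption turns it into ⟦N⟧_o'; the result is ⟦M{N/x}⟧_o.
    In ⟦(λx.M)N⟧_o, renaming [q] to [x] and merging the two quantifiers brings
    ⟦M⟧_p, ⟦N⟧_x and ⟨p;ō⟩ together, and the quantifiers on [p] and [x] are
    vacuous once both names have been consumed. *)

Set Implicit Arguments.
Unset Strict Implicit.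
Unset Printing Implicit Defensive.

Local Open Scope fset_scope.

(** * De Bruijn representation of structures *)

Inductive dbstruct : Type :=
| DUnit
| DPos of nat
| DNeg of nat
| DPar of dbstruct & dbstruct
| DCopar of dbstruct & dbstruct
| DSeq of dbstruct & dbstruct
| DSdq of dbstruct.

Definition bind (e : name -> nat) (a : name) : name -> nat :=
  fun x => if x == a then 0 else (e x).+1.

Fixpoint db (e : name -> nat) (R : structure) : dbstruct :=
  match R with
  | Unit => DUnit
  | Pos a => DPos (e a)
  | Neg a => DNeg (e a)
  | Par R T => DPar (db e R) (db e T)
  | Copar R T => DCopar (db e R) (db e T)
  | Seq R T => DSeq (db e R) (db e T)
  | Sdq a R => DSdq (db (bind e a) R)
  end.

Lemma bindK e a : bind e a a = 0.
Proof. by rewrite /bind eqxx. Qed.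

Lemma bind_neq e a x : x != a -> bind e a x = (e x).+1.
Proof. by rewrite /bind => /negbTE ->. Qed.

Lemma bind_inj e a : injective e -> injective (bind e a).
Proof.
move=> ei x y; rewrite /bind; case: eqP => [->|_]; case: eqP => [->|_] //.
by case=> /ei.
Qed.

Lemma updK (A : Type) (s : name -> A) a v : upd s a v a = v.
Proof. by rewrite /upd eqxx. Qed.

Lemma upd_neq (A : Type) (s : name -> A) a v x : x != a -> upd s a v x = s x.
Proof. by rewrite /upd => /negbTE ->. Qed.

Lemma fresh_default (x : name) (X : {fset name}) :
  (if x \in X then fresh X else x) \notin X.
Proof. by case: ifPn => // _; exact: freshP. Qed.

Lemma mem_neq (x y : name) (X : {fset name}) : x \in X -> y \notin X -> x != y.
Proof. by move=> xX; apply: contraNneq => <-. Qed.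

Lemma eq_in_db R e e' : {in fn R, e =1 e'} -> db e R = db e' R.
Proof.
elim: R e e' => [|a|a|R IR T IT|R IR T IT|R IR T IT|a R IR] e e' ee' //=.
- by rewrite ee' // inE.
- by rewrite ee' // inE.
- by rewrite (IR _ e') ?(IT _ e') // => x xR; apply: ee'; rewrite inE xR ?orbT.
- by rewrite (IR _ e') ?(IT _ e') // => x xR; apply: ee'; rewrite inE xR ?orbT.
- by rewrite (IR _ e') ?(IT _ e') // => x xR; apply: ee'; rewrite inE xR ?orbT.
congr DSdq; apply: IR => x xR; rewrite /bind; case: eqP => // /eqP xa.
by rewrite ee' // !inE xa.
Qed.

(** The bound name chosen by [srename] avoids the images of the other free names of the body, so
    nothing is captured and renaming amounts to precomposing the environment. *)
Lemma db_srename R s e : db e (srename s R) = db (e \o s) R.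
Proof.
elim: R s e => [|a|a|R IR T IT|R IR T IT|R IR T IT|a R IR] s e //=;
  rewrite ?IR ?IT //; congr DSdq; apply: eq_in_db => x xR /=.
set X := [fset _ | _ in _].
have := fresh_default a X; set c := if _ then _ else _ => cX.
rewrite /upd; case: eqP => [->|/eqP xa]; first by rewrite !bindK.
rewrite !bind_neq //; apply: mem_neq cX.
by apply/imfsetP; exists x => //=; rewrite !inE xa.
Qed.

(** Induction measure for [seqv_of_db], whose quantifier case recurses on renamed bodies: these are
    not subterms but keep their size. *)
Fixpoint ssize (R : structure) : nat :=
  match R with
  | Unit | Pos _ | Neg _ => 0
  | Par R T | Copar R T | Seq R T => (ssize R + ssize T).+1
  | Sdq _ R => (ssize R).+1
  end.

Lemma ssize_srename R s : ssize (srename s R) = ssize R.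
Proof.
by elim: R s => [|a|a|R IR T IT|R IR T IT|R IR T IT|a R IR] s //=;
  rewrite ?IR ?IT.
Qed.

Lemma db_srepl e R a c :
  c \notin fn R -> db (bind e c) (srepl R c a) = db (bind e a) R.
Proof.
move=> cR; rewrite db_srename; apply: eq_in_db => x xR /=.
rewrite /upd; case: eqP => [->|/eqP xa]; first by rewrite !bindK.
by rewrite !bind_neq //; apply: mem_neq cR.
Qed.

(** Equal representations force equal shapes, and two quantified bodies can be moved to a common
    fresh bound name by α-conversion. Injectivity of [e] recovers equal names at the atoms. *)
Lemma seqv_of_db R T e : injective e -> db e R = db e T -> R ≈ T.
Proof.
have [n] := ubnP (ssize R); elim: n R T e => // n IH R T e sR ei.
case: R sR => [|a|a|R1 R2|R1 R2|R1 R2|a R] /=;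
  case: T => [|b|b|T1 T2|T1 T2|T1 T2|b T] //=.
- by move=> _ _; exact: seqv_refl.
- by move=> _ [/ei ->]; exact: seqv_refl.
- by move=> _ [/ei ->]; exact: seqv_refl.
- rewrite ltnS => sR [E1 E2]; apply: seqv_par; apply: IH ei _ => //;
  by apply: leq_ltn_trans sR; rewrite ?leq_addl ?leq_addr.
- rewrite ltnS => sR [E1 E2]; apply: seqv_copar; apply: IH ei _ => //;
  by apply: leq_ltn_trans sR; rewrite ?leq_addl ?leq_addr.
- rewrite ltnS => sR [E1 E2]; apply: seqv_seq; apply: IH ei _ => //;
  by apply: leq_ltn_trans sR; rewrite ?leq_addl ?leq_addr.
rewrite ltnS => sR [E].
have := freshP (fn R `|` fn T); set c := fresh _.
rewrite inE negb_or => /andP[cR cT].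
apply: seqv_trans (seqv_sdq_alpha a cR) _.
apply: seqv_trans (seqv_sym (seqv_sdq_alpha b cT)).
apply: seqv_sdq; apply: (IH _ _ (bind e c)); first by rewrite ssize_srename.
  exact: bind_inj.
by rewrite !db_srepl.
Qed.

(** * The interpretation in de Bruijn form *)

(* ⟦M⟧_o in de Bruijn form, [e] giving the indices of the free variables. *)
Fixpoint dbinterp (e : name -> nat) (M : term) (o : nat) : dbstruct :=
  match M with
  | Var x => DSeq (DPos (e x)) (DNeg o)
  | Lam x M => DSdq (dbinterp (bind e x) M o.+1)
  | App M N =>
      DSdq (DPar (dbinterp (succn \o e) M 0)
                 (DPar (DSdq (dbinterp (succn \o (succn \o e)) N 0))
                       (DSeq (DPos 0) (DNeg o.+1))))
  end.

Lemma eq_in_dbinterp M e e' o :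
  {in fv M, e =1 e'} -> dbinterp e M o = dbinterp e' M o.
Proof.
elim: M e e' o => [x|x M IM|M IM N IN] e e' o ee' /=.
- by rewrite ee' // inE.
- congr DSdq; apply: IM => y yM; rewrite /bind; case: eqP => // /eqP yx.
  by rewrite ee' // !inE yx.
rewrite (IM _ (succn \o e')) ?(IN _ (succn \o (succn \o e'))) //= => y yM /=;
  by rewrite ee' // inE yM ?orbT.
Qed.

Lemma sub_fv_names M : {subset fv M <= names M}.
Proof.
elim: M => [x|x M IM|M IM N IN] y //=; rewrite !inE.
  by case/andP => _ /IM ->; rewrite orbT.
by case/orP => [/IM|/IN] ->; rewrite ?orbT.
Qed.

Lemma notin_fv M x : x \notin names M -> x \notin fv M.
Proof. by apply: contra; apply: sub_fv_names. Qed.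

Lemma dbinterp_bind e M p o :
  p \notin fv M -> dbinterp (bind e p) M o = dbinterp (succn \o e) M o.
Proof.
by move=> pM; apply: eq_in_dbinterp => x xM; rewrite bind_neq ?(mem_neq xM).
Qed.

Lemma dbinterp_bind2 e M p q o : p \notin fv M -> q \notin fv M ->
  dbinterp (bind (bind e p) q) M o = dbinterp (succn \o (succn \o e)) M o.
Proof.
move=> pM qM; apply: eq_in_dbinterp => x xM.
by rewrite !bind_neq ?(mem_neq xM).
Qed.

(** The auxiliary names [p] and [q] are fresh, so binding them only shifts the indices of free
    variables; when a binder clashes with [o], the renaming gives [o'] the index of the outer
    [o]. *)
Lemma db_interp M e o : db e (interp M o) = dbinterp e M (e o).
Proof.
elim: M e o => [x|x M IM|M IM N IN] e o //=.
- case: eqP => [->|/eqP xo]; last by rewrite /= IM bind_neq // eq_sym.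
  have := freshP (o |` names M); set o' := fresh _.
  rewrite !inE negb_or => /andP[o'o /notin_fv o'M].
  rewrite db_srename /= IM bind_neq //= updK; congr DSdq.
  apply: eq_in_dbinterp => y yM; rewrite /bind; case: eqP => //= _.
  by rewrite upd_neq // (mem_neq yM).
have := freshP (o |` (names M `|` names N)); set p := fresh _.
rewrite !inE !negb_or => /and3P[po /notin_fv pM /notin_fv pN].
have := freshP (p |` (o |` (names M `|` names N))); set q := fresh _.
rewrite !inE !negb_or => /and4P[_ _ _ /notin_fv qN].
rewrite IM IN !bindK dbinterp_bind // dbinterp_bind2 // bind_neq //.
by rewrite eq_sym.
Qed.

Lemma seqv_interp R M o : db id R = dbinterp id M o -> R ≈ interp M o.
Proof. by move=> E; apply: (@seqv_of_db _ _ id) => //; rewrite db_interp. Qed.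

(** The choice of bound names is invisible in de Bruijn form. Here [q] may equal [p], which is not
    free in [N]; several proofs below use one name for both. *)
Lemma interp_app M N o p q :
  p != o -> p \notin fv M -> p \notin fv N -> q \notin fv N ->
  Sdq p (Par (interp M p) (Par (Sdq q (interp N q)) (Seq (Pos p) (Neg o))))
    ≈ interp (App M N) o.
Proof.
move=> po pM pN qN; apply: seqv_interp => /=.
rewrite !db_interp !bindK dbinterp_bind // dbinterp_bind2 // bind_neq //.
by rewrite eq_sym.
Qed.

(** * Interpretation of substituted terms *)

Lemma fresh_tsubst_lam x M (s : name -> term) y :
  let X := \bigcup_(y <- fv M `\ x) fv (s y) in
  y \in fv M -> y != x -> (if x \in X then fresh X else x) \notin fv (s y).
Proof.
move=> X yM yx; apply: contra (fresh_default x X) => h.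
by apply/bigfcupP; exists y => //; rewrite !inE yx yM.
Qed.

(** The function [f] stands for the successors contributed by the binders crossed on the way to an
    occurrence of [y]; quantifying over it lets the hypothesis survive going under a binder. *)
Lemma eq_dbinterp_tsubst M s s' e e' o :
  (forall y, y \in fv M -> forall f o,
     dbinterp (f \o e) (s y) o = dbinterp (f \o e') (s' y) o) ->
  dbinterp e (tsubst s M) o = dbinterp e' (tsubst s' M) o.
Proof.
elim: M s s' e e' o => [x|x M IM|M IM N IN] s s' e e' o H.
- by apply: (H x _ id); rewrite /= inE.
- rewrite /=; congr DSdq; apply: IM => y yM f o1.
  have [->|yx] := eqVneq y x; first by rewrite !updK /= !bindK.
  rewrite !upd_neq //.
  have yMx : y \in fv M `\ x by rewrite !inE yx.
  rewrite (@eq_in_dbinterp _ _ ((f \o succn) \o e)); last first.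
    move=> v vs /=; rewrite bind_neq // (mem_neq vs) //.
    exact: fresh_tsubst_lam.
  rewrite (H y yMx (f \o succn)); apply: eq_in_dbinterp => v vs /=.
  rewrite bind_neq // (mem_neq vs) //; exact: fresh_tsubst_lam.
rewrite /= (IM _ s' _ (succn \o e')); first
  rewrite (IN _ s' _ (succn \o (succn \o e'))) //.
- by move=> y yN f o1; apply: (H y _ (f \o succn \o succn));
    rewrite /= inE yN orbT.
by move=> y yM f o1; apply: (H y _ (f \o succn)); rewrite /= inE yM.
Qed.

(** The counterpart of [db_srename] for terms, holding for the same reason. *)
Lemma dbinterp_tsubst_ren M s r e o : (forall x, s x = Var (r x)) ->
  dbinterp e (tsubst s M) o = dbinterp (e \o r) M o.
Proof.
elim: M s r e o => [x|x M IM|M IM N IN] s r e o sr /=.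
- by rewrite sr.
- set z := if _ then _ else _; congr DSdq.
  rewrite (IM _ (upd r x z)); last by move=> y; rewrite /upd; case: eqP.
  apply: eq_in_dbinterp => y yM /=.
  have [->|yx] := eqVneq y x; first by rewrite updK !bindK.
  rewrite upd_neq // !bind_neq // eq_sym.
  by have := @fresh_tsubst_lam x M s y yM yx; rewrite sr /= inE.
by rewrite (IM _ r) // (IN _ r).
Qed.

Lemma eq_interp_tsubst M s s' o :
  {in fv M, s =1 s'} -> interp (tsubst s M) o ≈ interp (tsubst s' M) o.
Proof.
move=> ss'; apply: seqv_interp; rewrite db_interp.
by apply: eq_dbinterp_tsubst => y yM f o1; rewrite ss'.
Qed.

Lemma interp_tsubst_Var M o : interp (tsubst Var M) o ≈ interp M o.
Proof.
by apply: seqv_interp; rewrite db_interp (@dbinterp_tsubst_ren _ _ id).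
Qed.

(** Lets later inductions trade the binder computed by [tsubst] for a name [w] that also avoids
    everything around the abstraction. *)
Lemma interp_tsubst_lam x M s o w :
  w != o -> (forall y, y \in fv M -> y != x -> w \notin fv (s y)) ->
  Sdq w (interp (tsubst (upd s x (Var w)) M) o) ≈ interp (tsubst s (Lam x M)) o.
Proof.
move=> wo ws; apply: seqv_interp => /=; congr DSdq.
rewrite db_interp bind_neq 1?eq_sym //.
apply: eq_dbinterp_tsubst => y yM f o1.
have [->|yx] := eqVneq y x; first by rewrite !updK /= !bindK.
rewrite !upd_neq //; apply: eq_in_dbinterp => v vs /=.
by rewrite !bind_neq // (mem_neq vs) ?ws //; exact: fresh_tsubst_lam.
Qed.

Lemma alpha_dbinterp M N e o : alpha M N -> dbinterp e M o = dbinterp e N o.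
Proof.
move=> a; elim: a e o => //=.
- by move=> ? ? ? _ IH1 _ IH2 e o; rewrite IH1.
- by move=> x ? ? _ IH e o; rewrite IH.
- by move=> ? ? ? ? _ IH1 _ IH2 e o; rewrite IH1 IH2.
move=> x y P yP e o; congr DSdq.
rewrite (@dbinterp_tsubst_ren _ _ (upd id x y)); last first.
  by move=> v; rewrite /upd; case: eqP.
apply: eq_in_dbinterp => v vP /=.
have [->|vx] := eqVneq v x; first by rewrite updK !bindK.
by rewrite upd_neq // !bind_neq // (mem_neq vP).
Qed.

Lemma linear_fv X M : linear_in X M -> fv M = X.
Proof.
elim=> //= [Y x P xY _ ->|Y Z P Q _ -> _ -> _] //.
by rewrite fsetU1K.
Qed.

(** * Composition and contextual closure of derivations *)

Lemma bvq_eqv T R : T ≈ R -> bvq_derivation T R.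
Proof. exact: deriv_nil. Qed.

Lemma bvq_trans T U R :
  bvq_derivation T U -> bvq_derivation U R -> bvq_derivation T R.
Proof.
move=> d; elim: d R => {T U} [T U TU|T T1 T2 U TT1 r _ IH] R UR.
  case: UR TU => {U R} [U R UR|U U1 U2 R UU1 r d] TU.
    exact: deriv_nil (seqv_trans TU UR).
  exact: deriv_cons (seqv_trans TU UU1) r d.
exact: deriv_cons TT1 r (IH _ UR).
Qed.

Lemma bvq_step T R : bvq_rule T R -> bvq_derivation T R.
Proof.
by move=> r; apply: deriv_cons (seqv_refl _) r (deriv_nil (seqv_refl _)).
Qed.

Lemma bvq_map (F : structure -> structure) :
  (forall T R, T ≈ R -> F T ≈ F R) ->
  (forall T R, bvq_rule T R -> bvq_rule (F T) (F R)) ->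
  forall T R, bvq_derivation T R -> bvq_derivation (F T) (F R).
Proof.
move=> Fe Fr T R; elim=> {T R} [T R TR|T T1 T2 R TT1 r _ IH].
  exact: deriv_nil (Fe _ _ TR).
exact: deriv_cons (Fe _ _ TT1) (Fr _ _ r) IH.
Qed.

Lemma bvq_parl T R U :
  bvq_derivation T R -> bvq_derivation (Par T U) (Par R U).
Proof.
apply: (@bvq_map (Par^~ U)) => [{}T {}R TR|{}T {}R [K a|K A B C|K A B C D|K a A B]].
- exact: seqv_par TR (seqv_refl _).
- exact: (rule_ai (ParL K U)).
- exact: (rule_s (ParL K U)).
- exact: (rule_q (ParL K U)).
- exact: (rule_u (ParL K U)).
Qed.

Lemma bvq_par T T' R R' : bvq_derivation T R -> bvq_derivation T' R' ->
  bvq_derivation (Par T T') (Par R R').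
Proof.
move=> d d'; apply: bvq_trans (bvq_parl _ d) _.
apply: bvq_trans (bvq_eqv (seqv_parC _ _)) _.
exact: bvq_trans (bvq_parl _ d') (bvq_eqv (seqv_parC _ _)).
Qed.

Lemma bvq_sdq a T R : bvq_derivation T R -> bvq_derivation (Sdq a T) (Sdq a R).
Proof.
apply: (@bvq_map (Sdq a)) => [{}T {}R TR|{}T {}R [K b|K A B C|K A B C D|K b A B]].
- exact: seqv_sdq TR.
- exact: (rule_ai (SdqC a K)).
- exact: (rule_s (SdqC a K)).
- exact: (rule_q (SdqC a K)).
- exact: (rule_u (SdqC a K)).
Qed.

Lemma bvq_refl T : bvq_derivation T T.
Proof. exact: bvq_eqv (seqv_refl _). Qed.

Lemma bvq_u a R U : bvq_derivation (Sdq a (Par R U)) (Par (Sdq a R) (Sdq a U)).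
Proof. exact: bvq_step (rule_u Hole a R U). Qed.

Lemma bvq_extrude a R U : a \notin fn U ->
  bvq_derivation (Sdq a (Par R U)) (Par (Sdq a R) U).
Proof.
move=> aU; apply: bvq_trans (bvq_u _ _ _) (bvq_eqv _).
exact: seqv_par (seqv_refl _) (seqv_sdq_vac aU).
Qed.

Lemma seqv_parCA R T U : Par R (Par T U) ≈ Par T (Par R U).
Proof.
apply: seqv_trans (seqv_parA _ _ _) _.
apply: seqv_trans (seqv_par (seqv_parC _ _) (seqv_refl _)) _.
exact: seqv_sym (seqv_parA _ _ _).
Qed.

Lemma seqv_parAC R T U : Par (Par R T) U ≈ Par (Par R U) T.
Proof.
apply: seqv_trans (seqv_sym (seqv_parA _ _ _)) _.
apply: seqv_trans (seqv_par (seqv_refl _) (seqv_parC _ _)) _.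
exact: seqv_parA.
Qed.

(** * Absorbing a link into an output *)

Lemma bvq_cut x p o :
  bvq_derivation (Seq (Pos x) (Neg o))
                 (Par (Seq (Pos x) (Neg p)) (Seq (Pos p) (Neg o))).
Proof.
pose L := Seq (Pos p) (Neg o).
have par0r R : R ≈ Par R Unit.
  exact: seqv_trans (seqv_sym (seqv_par0 _)) (seqv_parC _ _).
(* Reading upwards from the conclusion, [rule_q] with a unit puts the link beside [Neg p], a second
   [rule_q] with a unit brings [Pos p] against [Neg p], and [rule_ai] erases the pair. The
   derivation is built from the premise, hence in the opposite order. *)
have step1 : bvq_derivation (Seq (Pos x) (Neg o))
    (Seq (Pos x) (Seq (Par (Pos p) (Neg p)) (Neg o))).
  apply: deriv_cons _ (rule_ai (SeqR (Pos x) (SeqL Hole (Neg o))) p) (bvq_refl _).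
  apply: seqv_seq (seqv_refl _) _; exact: seqv_sym (seqv_seq0l _).
apply: bvq_trans step1 _.
have step2 : bvq_derivation (Seq (Pos x) (Seq (Par (Pos p) (Neg p)) (Neg o)))
    (Seq (Pos x) (Par (Neg p) L)).
  apply: deriv_cons _ (rule_q (SeqR (Pos x) Hole) (Neg p) Unit (Pos p) (Neg o)) _.
    apply: seqv_seq (seqv_refl _) _.
    apply: seqv_seq (seqv_parC _ _) (seqv_sym (seqv_par0 _)).
  apply: bvq_eqv => /=; apply: seqv_seq (seqv_refl _) _.
  exact: seqv_par (seqv_seq0r _) (seqv_refl _).
apply: bvq_trans step2 _.
apply: deriv_cons _ (rule_q Hole (Pos x) (Neg p) Unit L) _.
  exact: seqv_seq (par0r _) (seqv_refl _).
by apply: bvq_eqv; apply: seqv_par (seqv_refl _) (seqv_seq0l _).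
Qed.

(** The statement carries a substitution because an abstraction is entered with its binder renamed
    to a fresh [w]. An application needs no induction hypothesis: its output occurs only in its own
    link, where [bvq_cut] applies. *)
Lemma interp_link_tsubst M s p o :
  (forall x p o, bvq_derivation (interp (s x) o)
     (Par (interp (s x) p) (Seq (Pos p) (Neg o)))) ->
  bvq_derivation (interp (tsubst s M) o)
    (Par (interp (tsubst s M) p) (Seq (Pos p) (Neg o))).
Proof.
elim: M s p o => [x|x M IM|M IM N IN] s p o Hs; first exact: Hs.
- have := freshP (o |` (p |` \bigcup_(y <- fv M) fv (s y))); set w := fresh _.
  rewrite !inE !negb_or => /and3P[wo wp wX].
  have ws y : y \in fv M -> y != x -> w \notin fv (s y).
    by move=> yM _; apply: contra wX => h; apply/bigfcupP; exists y; rewrite ?yM.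
  apply: bvq_trans (bvq_eqv (seqv_sym (interp_tsubst_lam wo ws))) _.
  apply: bvq_trans (bvq_parl _ (bvq_eqv (interp_tsubst_lam wp ws))).
  apply: bvq_trans (bvq_extrude _ _); last by rewrite /= !inE negb_or wp.
  apply: bvq_sdq; apply: IM => y p1 o1; rewrite /upd; case: eqP => // _.
  exact: bvq_cut.
rewrite [tsubst _ _]/=; set M' := tsubst s M; set N' := tsubst s N.
have := freshP (o |` (p |` (fv M' `|` fv N'))); set q := fresh _.
rewrite !inE !negb_or => /and4P[qo qp qM qN].
apply: bvq_trans (bvq_eqv (seqv_sym (interp_app qo qM qN qN))) _.
apply: bvq_trans (bvq_parl _ (bvq_eqv (interp_app qp qM qN qN))).
apply: bvq_trans (bvq_extrude _ _); last by rewrite /= !inE negb_or qp.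
apply: bvq_sdq.
apply: bvq_trans (bvq_eqv (seqv_parA _ _ _)).
apply: bvq_par (bvq_refl _) _.
apply: bvq_trans (bvq_eqv (seqv_parA _ _ _)).
exact: bvq_par (bvq_refl _) (bvq_cut _ _ _).
Qed.

Lemma interp_link M p o : bvq_derivation (interp M o)
  (Par (interp M p) (Seq (Pos p) (Neg o))).
Proof.
apply: bvq_trans (bvq_eqv (seqv_sym (interp_tsubst_Var M o))) _.
apply: bvq_trans (bvq_parl _ (bvq_eqv (interp_tsubst_Var M p))).
by apply: interp_link_tsubst => x p1 o1; exact: bvq_cut.
Qed.

(** * Routing the argument to the linear variable *)

(* The name [z] is left free: under a quantifier on [z], the application case
   would need [Sdq z.R; U] as premise of Sdq z.[R; U], which [rule_u] only
   gives in the other direction.  The quantifier is added once [z] is gone. *)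
Lemma interp_tsubst_linear X M s x z o :
  linear_in X M -> x \in X ->
  bvq_derivation (interp (tsubst s M) o)
    (Par (interp (tsubst (upd s x (Var z)) M) o) (interp (s x) z)).
Proof.
move=> lin; elim: lin s o => {X M} [y|X y M yX lM IM|X Y M N lM IM lN IN dXY] s o.
- rewrite inE => /eqP <-; rewrite [tsubst (upd _ _ _) _]updK.
  exact: bvq_trans (interp_link _ z o) (bvq_eqv (seqv_parC _ _)).
- move=> xX; have xy : x != y by apply: mem_neq yX.
  (* Avoiding the free names of ⟦s x⟧_z lets that structure leave the scope of the quantifier on
     [w]. *)
  have := freshP (o |` (z |` (fn (interp (s x) z) `|`
                   \bigcup_(y <- fv M) fv (s y)))); set w := fresh _.
  rewrite !inE !negb_or => /and4P[wo wz wB wX].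
  have ws v : v \in fv M -> v != y -> w \notin fv (s v).
    by move=> vM _; apply: contra wX => h; apply/bigfcupP; exists v; rewrite ?vM.
  have ws' v : v \in fv M -> v != y -> w \notin fv (upd s x (Var z) v).
    by move=> vM vy; rewrite /upd; case: eqP; rewrite ?ws //= inE.
  apply: bvq_trans (bvq_eqv (seqv_sym (interp_tsubst_lam wo ws))) _.
  apply: bvq_trans (bvq_parl _ (bvq_eqv (interp_tsubst_lam wo ws'))).
  apply: bvq_trans (bvq_extrude _ wB); apply: bvq_sdq.
  have xyX : x \in y |` X by rewrite !inE xX orbT.
  apply: bvq_trans (IM _ _ xyX) _; rewrite upd_neq //.
  apply: bvq_parl (bvq_eqv _); apply: eq_interp_tsubst => v vM.
  rewrite /upd; have [->|//] := eqVneq v x; by rewrite (negbTE xy).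
set B := interp (s x) z; set s' := upd s x (Var z) => xXY.
(* Linearity leaves [x] free in only one of [M] and [N]; [same] handles the other. *)
have same P : x \notin fv P ->
    forall o, interp (tsubst s P) o ≈ interp (tsubst s' P) o.
  move=> xP o1; apply: eq_interp_tsubst => v vP.
  by rewrite /s' upd_neq // (mem_neq vP).
have := freshP (o |` (fn B `|` (fv (tsubst s M) `|` (fv (tsubst s N) `|`
          (fv (tsubst s' M) `|` fv (tsubst s' N)))))); set p := fresh _.
rewrite !inE !negb_or => /andP[po /andP[pB /and4P[pM pN pM' pN']]].
apply: bvq_trans (bvq_eqv (seqv_sym (interp_app po pM pN pN))) _.
apply: bvq_trans (bvq_parl _ (bvq_eqv (interp_app po pM' pN' pN'))).
apply: bvq_trans (bvq_extrude _ pB); apply: bvq_sdq.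
move: xXY; rewrite inE; case: (boolP (x \in X)) => [xX _|xX /= xY].
- have xN : x \notin fv N by rewrite (linear_fv lN); exact: (fdisjointP dXY).
  apply: bvq_trans (bvq_eqv (seqv_parAC _ _ _)).
  apply: bvq_par (IM _ _ xX) (bvq_eqv _).
  exact: seqv_par (seqv_sdq _ (same _ xN _)) (seqv_refl _).
apply: bvq_trans (bvq_eqv (seqv_parA _ _ _)); apply: bvq_par.
  by apply: bvq_eqv; apply: same; rewrite (linear_fv lM).
apply: bvq_trans (bvq_eqv (seqv_parAC _ _ _)); apply: bvq_parl.
(* The quantifier around the argument is also on [p], so [pB] serves a second time. *)
apply: bvq_trans (bvq_extrude _ pB); apply: bvq_sdq; exact: IN.
Qed.

(** * Simulation of reduction *)

Lemma interp_beta X M N s x o : linear_in X M -> x \in X ->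
  bvq_derivation (interp (tsubst (upd s x (tsubst s N)) M) o)
                 (interp (tsubst s (App (Lam x M) N)) o).
Proof.
move=> lM xX; set Q := tsubst (upd s x _) M; set N' := tsubst s N.
(* [L] is kept opaque, so that freshness for the substituted abstraction stays a condition on
   [fv L]. *)
have [L defL] : exists L, L = tsubst s (Lam x M) by eexists.
have -> : tsubst s (App (Lam x M) N) = App L N' by rewrite defL.
have := freshP (o |` (fn (interp Q o) `|` (fv L `|` fv N'))).
set p := fresh _; rewrite !inE !negb_or => /and4P[po pQ pM pN].
have := freshP (o |` (p |` (fn (interp Q o) `|` (fv N' `|`
          \bigcup_(y <- fv M) fv (s y))))).
set z := fresh _; rewrite !inE !negb_or => /andP[zo /and4P[zp zQ zN zX]].
have zs v : v \in fv M -> v != x -> z \notin fv (s v).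
  by move=> vM _; apply: contra zX => h; apply/bigfcupP; exists v; rewrite ?vM.
(* [z] names both the quantifier around the argument and the renamed binder of the abstraction, so
   that [bvq_u] can merge the two. *)
apply: bvq_trans (bvq_eqv (interp_app po pM pN zN)); rewrite defL.
(* Seen from the premise, ⟦Q⟧_o is first wrapped in vacuous quantifiers on [p] and [z]. *)
apply: bvq_trans (bvq_eqv (seqv_sym (seqv_sdq_vac pQ))) (bvq_sdq _ _).
apply: bvq_trans (bvq_eqv (seqv_sym (seqv_sdq_vac zQ))) _.
apply: bvq_trans (bvq_parl _ (bvq_eqv (interp_tsubst_lam zp zs))).
apply: bvq_trans (bvq_eqv (seqv_sym (seqv_parA _ _ _))).
apply: bvq_trans (bvq_parl _ (bvq_u _ _ _)).
apply: bvq_trans (bvq_extrude _ _); last by rewrite /= !inE negb_or zp.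
apply: bvq_sdq; apply: bvq_trans (bvq_eqv (seqv_parAC _ _ _)).
apply: bvq_trans (bvq_parl _ (interp_link _ _ _)).
(* The substitution used here already sends [x] to [N']; the update by [Var z] then overrides it. *)
apply: bvq_trans (interp_tsubst_linear _ z _ lM xX) _; rewrite updK.
apply: bvq_parl (bvq_eqv _); apply: eq_interp_tsubst => v _.
by rewrite /upd; case: eqP.
Qed.

(* Generalizing over renamings lets a binder that clashes with the output name
   be replaced by the same fresh name on both sides of a reduction. *)
Lemma red_bvq_ren M N s r o : (forall x, s x = Var (r x)) -> M ⇒ N ->
  bvq_derivation (interp (tsubst s N) o) (interp (tsubst s M) o).
Proof.
move=> sr MN; elim: MN s r o sr => {M N}
  [M N _ a|x M N [Y lin]|M P N _ IH1 _ IH2|x M N _ _ IH|M N P _ _ IH|M N P _ _ IH]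
  s r o sr.
- apply: bvq_eqv; apply: seqv_interp.
  by rewrite db_interp !(dbinterp_tsubst_ren _ _ _ sr) (alpha_dbinterp _ _ a).
- inversion lin as [| |X1 X2 M1 N1 linL]; subst.
  inversion linL as [|X3 x3 M3 xX linM|]; subst.
  have xM : x \in x |` X1 by rewrite !inE eqxx.
  apply: bvq_trans (interp_beta N s o linM xM).
  (* Renaming the contractum agrees, in de Bruijn form, with substituting the renamed argument while
     renaming the body. *)
  apply: bvq_eqv; apply: seqv_interp.
  rewrite db_interp (dbinterp_tsubst_ren _ _ _ sr).
  apply: eq_dbinterp_tsubst => y yM f o1; rewrite /upd; case: eqP => _.
    by rewrite (dbinterp_tsubst_ren _ _ _ sr).
  by rewrite sr.
- exact: bvq_trans (IH2 s r o sr) (IH1 s r o sr).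
- have := freshP (o |` (\bigcup_(y <- fv M) fv (s y) `|`
                        \bigcup_(y <- fv N) fv (s y))); set w := fresh _.
  rewrite !inE !negb_or => /and3P[wo wM wN].
  apply: bvq_trans (bvq_eqv (interp_tsubst_lam wo _)); last first.
    by move=> v vM _; apply: contra wM => h; apply/bigfcupP; exists v; rewrite ?vM.
  apply: bvq_trans (bvq_eqv (seqv_sym (interp_tsubst_lam wo _))) _.
    by move=> v vN _; apply: contra wN => h; apply/bigfcupP; exists v; rewrite ?vN.
  apply: bvq_sdq; apply: (IH _ (upd r x w)) => v.
  by rewrite /upd; case: eqP.
- have := freshP (o |` (fv (tsubst s M) `|` (fv (tsubst s N) `|` fv (tsubst s P)))).
  set p := fresh _; rewrite !inE !negb_or => /and4P[po pM pN pP].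
  apply: bvq_trans (bvq_eqv (interp_app po pM pP pP)).
  apply: bvq_trans (bvq_eqv (seqv_sym (interp_app po pN pP pP))) _.
  by apply: bvq_sdq; apply: bvq_parl; exact: (IH s r _ sr).
have := freshP (o |` (fv (tsubst s M) `|` (fv (tsubst s N) `|` fv (tsubst s P)))).
set p := fresh _; rewrite !inE !negb_or => /and4P[po pM pN pP].
apply: bvq_trans (bvq_eqv (interp_app po pP pM pM)).
apply: bvq_trans (bvq_eqv (seqv_sym (interp_app po pP pN pN))) _.
apply: bvq_sdq; apply: bvq_par (bvq_refl _) _; apply: bvq_parl; apply: bvq_sdq.
exact: (IH s r _ sr).
Qed.

Theorem mainTheorem1 (M N : term) (o : name)
    (linM : linear_term M) (linN : linear_term N) :
  M ⇒ N -> bvq_derivation (interp N o) (interp M o).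
Proof.
move=> MN; apply: bvq_trans (bvq_eqv (interp_tsubst_Var M o)).
apply: bvq_trans (bvq_eqv (seqv_sym (interp_tsubst_Var N o))) _.
exact: (@red_bvq_ren _ _ _ id).
Qed.
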